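(* Let $T$ be a finite tree, let $k$ be a positive integer with $k\le |T|$, and let $S\subseteq T$ be a $k$-maximal subtree of $T$. Then $S$ contains at most one leaf (of $S$) whose degree in $T$ is greater than $2$, and at least one leaf (of $S$) whose degree in $T$ is at most $2$.
   Context: A subtree of a tree $T$ is a nonempty connected subgraph; $|T|$ denotes the number of vertices of $T$. For a subtree $S\subseteq T$, let $N_T(S)$ be the number of subtrees of $T$ containing $S$ and $R_T(S)$ the sum of the orders (numbers of vertices) of all subtrees of $T$ containing $S$. The local mean at $S$ is $\mu_T(S)=R_T(S)/N_T(S)$. A $k$-maximal subtree of $T$ is a subtree of order $k$ whose local mean is maximal among all subtrees of $T$ of order $k$. A leaf of $S$ is a vertex of degree $1$ in $S$; if $S$ has only one vertex, that vertex is regarded as the (only) leaf of $S$. $\deg_T(v)$ is the degree of $v$ in $T$. *)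

(* Defs.v *)
From mathcomp Require Import all_boot all_order all_algebra.

Set Implicit Arguments.
Unset Strict Implicit.
Unset Printing Implicit Defensive.

Import Order.TTheory GRing.Theory Num.Theory.

(* A pair (vertex set, edge set) over an ambient finite type of vertex names;
   a graph and its subgraphs are values of the same finite type.  Only the
   pairs satisfying [is_graph] below are simple graphs. *)
Definition graph (V : finType) : Type := ({set V} * {set {set V}})%type.

Definition vertices (V : finType) (G : graph V) : {set V} := G.1.
Definition edges (V : finType) (G : graph V) : {set {set V}} := G.2.

Definition is_graph (V : finType) (G : graph V) : bool :=
  [forall A in edges G, (A \subset vertices G) && (#|A| == 2)].

Definition adj (V : finType) (G : graph V) : rel V :=
  [rel x y | [set x; y] \in edges G].

Definition gorder (V : finType) (G : graph V) : nat := #|vertices G|.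

Definition deg (V : finType) (G : graph V) (v : V) : nat :=
  #|[set w | adj G v w]|.

Definition connected (V : finType) (G : graph V) : bool :=
  [forall x in vertices G, forall y in vertices G, connect (adj G) x y].

(* In a simple graph, [cycle (adj G) [:: x; y]] only says that xy is an edge,
   so genuine cycles are those with at least three distinct vertices. *)
Definition acyclic (V : finType) (G : graph V) : Prop :=
  forall c : seq V, uniq c -> cycle (adj G) c -> size c <= 2.

Definition is_tree (V : finType) (T : graph V) : Prop :=
  [/\ is_graph T, vertices T != set0, connected T & acyclic T].

(* Inclusion of graphs; not necessarily induced. *)
Definition subgraph (V : finType) (H G : graph V) : bool :=
  (vertices H \subset vertices G) && (edges H \subset edges G).

Definition subtree (V : finType) (T S : graph V) : bool :=
  [&& is_graph S, subgraph S T, vertices S != set0 & connected S].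

Definition num_subtrees (V : finType) (T S : graph V) : nat :=
  #|[pred H : graph V | subtree T H && subgraph S H]|.

Definition sum_orders (V : finType) (T S : graph V) : nat :=
  \sum_(H : graph V | subtree T H && subgraph S H) gorder H.

Definition local_mean (V : finType) (T S : graph V) : rat :=
  ((sum_orders T S)%:R / (num_subtrees T S)%:R)%R.

Definition k_maximal (V : finType) (T : graph V) (k : nat) (S : graph V) :
    Prop :=
  [/\ subtree T S, gorder S = k &
      forall S' : graph V, subtree T S' -> gorder S' = k ->
        (local_mean T S' <= local_mean T S)%R].

(* The unique vertex of a one-vertex graph counts as a leaf. *)
Definition leaf (V : finType) (S : graph V) (v : V) : bool :=
  (v \in vertices S) && ((deg S v == 1) || (gorder S == 1)).

(* Main.v *)
Require Import Defs.
From mathcomp Require Import all_boot all_order all_algebra.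
From mathcomp Require Import ring lra.

Set Implicit Arguments.
Unset Strict Implicit.
Unset Printing Implicit Defensive.

Import Order.TTheory GRing.Theory Num.Theory.

(** For a connected vertex set X of T let f be the generating polynomial of the
    subtrees containing X, each counted as 'X^(its order).  The local mean at X
    is the logarithmic derivative f'(1) / f(1), so it turns products into sums.

    If x is a vertex outside X adjacent to p in X, cutting the edge px splits
    the subtrees containing x |: X into pairs, so f factors
    ([subtree_poly_factor]), and the local mean grows by an amount
      [gain p x] = m / (1 + N)
    when x is added to X ([mean_extend]); here N and m are the number and the
    mean order of the subtrees that contain x but not p.  The gain depends on
    the directed edge px only, not on X.  Hence exchanging a leaf u of X,
    hanging from q, for a new vertex c, hanging from p, changes the local mean
    by [gain p c - gain q u], which is never positive if X is maximal
    ([k_maximal_gain]).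

    The heart of the proof is [gain_branch]: if u has degree at least 3 and p is
    a neighbour of u, then some other neighbour c of u has
    [gain u c > gain p u].  Now let X be maximal.

    If X had two leaves u and v of degree at least 3 in T, with neighbours p and
    q in X, then exchanging v for a neighbour c of u outside X would give
    [gain p u < gain u c <= gain q v], and by symmetry [gain q v < gain p u].
    As a tree of order at least 2 has two leaves, one of them has degree at most
    2 in T.

    If X = {v} and v had degree at least 3, let w be the neighbour of v with the
    largest [gain v w].  Some neighbour c has
    [gain w v < gain v c <= gain v w], so w would have a larger local mean
    than v. *)

(** * Logarithmic derivatives at 1 and an inequality on products *)

Section Mean.

Local Open Scope ring_scope.

(** For a generating polynomial counting objects by their size, this is the
    mean size. *)
Definition mean (f : {poly rat}) : rat := f^`().[1] / f.[1].

Lemma meanM f g : f.[1] != 0 -> g.[1] != 0 -> mean (f * g) = mean f + mean g.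
Proof.
move=> f0 g0; rewrite /mean derivM hornerD !hornerM; field.
by rewrite f0 g0.
Qed.

Lemma mean_add1 (f : {poly rat}) : 0 < f.[1] ->
  mean (1 + f) = mean f - mean f / (1 + f.[1]).
Proof.
move=> f0; have f1 : 1 + f.[1] != 0 by rewrite gt_eqF // addr_gt0.
by rewrite /mean derivD -polyC1 derivC add0r hornerD hornerC; field; rewrite f1 gt_eqF.
Qed.

Lemma mean_prod (I : finType) (P : pred I) (F : I -> {poly rat}) :
  (forall i, P i -> (F i).[1] != 0) ->
  mean (\prod_(i | P i) F i) = \sum_(i | P i) mean (F i).
Proof.
move=> F0.
pose K (f : {poly rat}) s := f.[1] != 0 /\ mean f = s.
suff [] : K (\prod_(i | P i) F i) (\sum_(i | P i) mean (F i)) by [].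
apply: (big_rec2 K); first by rewrite /K /mean -polyC1 derivC hornerC horner0 mul0r oner_neq0.
move=> i f s Pi [f0 <-]; split; first by rewrite hornerM mulf_neq0 ?F0.
by rewrite meanM ?F0.
Qed.

Lemma prod_add1_ge (I : finType) (P : pred I) (F : I -> rat) :
  (forall i, P i -> 0 <= F i) ->
  1 + \sum_(i | P i) F i <= \prod_(i | P i) (1 + F i).
Proof.
move=> F0; pose K (s t : rat) := 0 <= s /\ 1 + s <= t.
suff [] : K (\sum_(i | P i) F i) (\prod_(i | P i) (1 + F i)) by [].
apply: (big_rec2 K); first by rewrite /K addr0.
by move=> i t s /F0 Fi [s0 st]; split; nra.
Qed.

(** The product term [F i * F j] is what makes the inequality of [gain_branch]
    strict. *)
Lemma prod_add1_ge2 (I : finType) (P : pred I) (F : I -> rat) i j :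
  (forall i, P i -> 0 <= F i) -> P i -> P j -> j != i ->
  1 + \sum_(k | P k) F k + F i * F j <= \prod_(k | P k) (1 + F k).
Proof.
move=> F0 Pi Pj ji; rewrite (bigD1 i) // [X in _ <= X](bigD1 i) //=.
rewrite (bigD1 j) /= ?Pj // [X in _ <= _ * X](bigD1 j) /= ?Pj //.
have := @prod_add1_ge _ (fun k => P k && (k != i) && (k != j)) F.
have := F0 i Pi; have := F0 j Pj.
have : 0 <= \sum_(k | P k && (k != i) && (k != j)) F k.
  by apply: sumr_ge0 => k /andP[/andP[/F0]].
set s := \sum_(k | _) _; set t := \prod_(k | _) _ => s0 Fj Fi st.
have {}st : 1 + s <= t by apply: st => k /andP[/andP[/F0]].
rewrite mulrA; apply: le_trans (_ : _ <= (1 + F i) * (1 + F j) * (1 + s)) _.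
  by have := mulr_ge0 Fi Fj; nra.
by rewrite ler_wpM2l // mulr_ge0 // addr_ge0.
Qed.

End Mean.

(** * Connected vertex sets and edge cuts of a forest *)

Lemma connect_crosses (V : finType) (r : rel V) (B : {set V}) x y :
  connect r x y -> x \in B -> y \notin B ->
  exists a b, [/\ a \in B, b \notin B & r a b].
Proof.
move=> /connectP[c rc ->] {y}.
elim: c x rc => [|z c IHc] x /=; first by move=> _ ->.
case/andP=> rxz rc xB lB; have [zB|zB] := boolP (z \in B); last by exists x, z.
exact: IHc rc zB lB.
Qed.

Lemma connect_image (V : finType) (r r' : rel V) (f : V -> V) x y :
  (forall a b, r a b -> connect r' (f a) (f b)) ->
  connect r x y -> connect r' (f x) (f y).
Proof.
move=> rf /connectP[c rc ->] {y}.
elim: c x rc => [|z c IHc] x //= /andP[/rf xz /IHc].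
exact: connect_trans.
Qed.

Section Forest.

Variables (V : finType) (e : rel V).
Hypothesis e_sym : symmetric e.
Hypothesis e_irr : irreflexive e.
Hypothesis e_acyclic : forall c : seq V, uniq c -> cycle e c -> size c <= 2.

Implicit Types (p u x y : V) (X Y Z B C D : {set V}).

Definition induced Y : rel V := [rel a b | [&& e a b, a \in Y & b \in Y]].

Definition conn Y := [forall x in Y, forall y in Y, connect (induced Y) x y].

Lemma connP Y :
  reflect {in Y &, forall x y, connect (induced Y) x y} (conn Y).
Proof.
apply: (iffP forall_inP) => [cY x y xY yY|cY x xY]; first exact: forall_inP (cY x xY) y yY.
by apply/forall_inP => y; apply: cY.
Qed.

Lemma induced_sym Y : symmetric (induced Y).
Proof. by move=> a b; rewrite /induced /= e_sym [(a \in Y) && _]andbC. Qed.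

Lemma connect_induced_sub Y Z x y :
  Y \subset Z -> connect (induced Y) x y -> connect (induced Z) x y.
Proof.
move=> YZ; apply: connect_sub => a b /and3P[ab /(subsetP YZ) aZ /(subsetP YZ) bZ].
by apply: connect1; rewrite /induced /= ab aZ.
Qed.

Lemma conn1 x : conn [set x].
Proof. by apply/connP => a b /set1P-> /set1P->. Qed.

Lemma connU Y Z a b : conn Y -> conn Z -> a \in Y -> b \in Z -> e a b ->
  conn (Y :|: Z).
Proof.
move=> /connP cY /connP cZ aY bZ ab.
have toa z : z \in Y :|: Z -> connect (induced (Y :|: Z)) a z.
  case/setUP=> [zY|zZ]; first exact: connect_induced_sub (subsetUl _ _) (cY _ _ aY zY).
  apply: connect_trans (connect_induced_sub (subsetUr _ _) (cZ _ _ bZ zZ)).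
  by apply: connect1; rewrite /induced /= ab !inE aY bZ orbT.
apply/connP=> x y /toa xa /toa ya; apply: connect_trans ya.
by rewrite (sym_connect_sym (induced_sym _)).
Qed.

Lemma conn_add X x p : conn X -> p \in X -> e p x -> conn (x |: X).
Proof. by move=> cX pX px; rewrite setUC; apply: connU cX (conn1 x) pX (set11 x) px. Qed.

Lemma conn_crosses Y B x y : conn Y -> x \in Y -> y \in Y -> x \in B -> y \notin B ->
  exists a b, [/\ a \in B, b \notin B, a \in Y, b \in Y & e a b].
Proof.
move=> /connP cY xY yY xB yB.
have [a [b [aB bB /and3P[ab aY bY]]]] := connect_crosses (cY _ _ xY yY) xB yB.
by exists a, b.
Qed.

(** A map that fixes Z and contracts or preserves edges carries walks in Y to
    walks in Z.  It proves connectedness after pruning: f sends the pruned part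
    to the vertex at which it was attached. *)
Lemma conn_retract Y Z f : conn Y -> Z \subset Y -> {in Z, f =1 id} ->
    (forall a b, a \in Y -> b \in Y -> e a b -> connect (induced Z) (f a) (f b)) ->
  conn Z.
Proof.
move=> /connP cY ZY fZ fe; apply/connP=> x y xZ yZ.
rewrite -(fZ x xZ) -(fZ y yZ); apply: (connect_image _ (cY _ _ _ _)).
- by move=> a b /and3P[ab aY bY]; apply: fe.
- exact: (subsetP ZY).
- exact: (subsetP ZY).
Qed.

Lemma conn_remove_leaf X u p : conn X -> p \in X -> p != u ->
  (forall w, w \in X -> e u w -> w = p) -> conn (X :\ u).
Proof.
move=> cX pX pu leafu.
apply: (@conn_retract X _ (fun y => if y == u then p else y)) => //.
- exact: subD1set.
- by move=> y /setD1P[/negPf-> _].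
move=> a b aX bX ab.
have [au|au] := eqVneq a u; have [bu|bu] := eqVneq b u => //.
- by rewrite (leafu b) // -au.
- by rewrite (leafu a) // -bu e_sym.
by apply: connect1; rewrite /induced /= ab !inE au aX bu.
Qed.

(** When p and x are adjacent in a forest, the side of x after the edge px is
    cut: a path that avoids the vertex p does not use that edge. *)
Definition side p x := [set y | connect (induced [set~ p]) x y].

Lemma side_root p x : x \in side p x.
Proof. by rewrite inE connect0. Qed.

Lemma edge_neq p x : e p x -> p != x.
Proof. by apply: contraTneq => ->; rewrite e_irr. Qed.

Lemma notin_side p x : e p x -> p \notin side p x.
Proof.
move=> /edge_neq px; apply/negP; rewrite inE => xp.
have xB : x \in [set~ p] by rewrite !inE eq_sym.
have pB : p \notin [set~ p] by rewrite !inE eqxx.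
by have [a [b [_ /negPf bp /and3P[_ _]]]] := connect_crosses xp xB pB; rewrite bp.
Qed.

(** The edge px is the only one that leaves [side p x]: another one would end at
    p and close a cycle through px.  Every later use of acyclicity goes through
    this fact. *)
Lemma side_exit p x a b : e p x -> a \in side p x -> b \notin side p x -> e a b ->
  a = x /\ b = p.
Proof.
move=> px aB bB ab.
have ap : a != p by apply: contraTneq aB => ->; apply: notin_side.
have bp : b = p.
  apply/eqP; apply: contraNT bB => bp; move: aB; rewrite !inE => xa.
  by apply: connect_trans xa (connect1 _); rewrite /induced /= ab !inE ap.
split=> //; move: aB; rewrite inE => /connectP[c0 c0P la].
move: la; case/shortenP: c0P => c cP uc _ la {c0}.
have cN : forall z, z \in c -> z != p.
  move: (x) cP {uc la px}; elim: c => // z c IHc x' /= /andP[/and3P[_ _ zp] zc] t.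
  by rewrite inE => /predU1P[->|]; [rewrite !inE in zp | apply: IHc zc _].
have ec : path e x c by apply: sub_path cP => ? ? /and3P[].
have upc : uniq (p :: x :: c).
  rewrite cons_uniq uc andbT inE negb_or edge_neq //.
  by apply/negP=> /cN; rewrite eqxx.
have cpc : cycle e (p :: x :: c) by rewrite /= px rcons_path ec -la -bp ab.
by have := e_acyclic upc cpc; case: (c) la.
Qed.

Lemma side_trap p x Y y : e p x -> conn Y -> x \in Y -> p \notin Y -> y \in Y ->
  y \in side p x.
Proof.
move=> px /connP cY xY pY yY; rewrite inE.
by apply: connect_induced_sub (cY _ _ xY yY); rewrite subsetC sub1set inE.
Qed.

Lemma side_avoid p x Y y : e p x -> conn Y -> p \in Y -> x \notin Y -> y \in Y ->
  y \notin side p x.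
Proof.
move=> px cY pY xY yY; apply/negP=> yB.
have [a [b [aB bB aY bY ab]]] := conn_crosses cY yY pY yB (notin_side px).
by have [ax _] := side_exit px aB bB ab; rewrite -ax aY in xY.
Qed.

Lemma connI_side p x Y : e p x -> conn Y -> x \in Y -> conn (Y :&: side p x).
Proof.
move=> px cY xY; set B := side p x.
apply: (@conn_retract Y _ (fun y => if y \in B then y else x)) => //.
- exact: subsetIl.
- by move=> y /setIP[_ ->].
move=> a b aY bY ab.
case: ifPn => aB; case: ifPn => bB //.
- by apply: connect1; rewrite /induced /= ab ?in_setI ?in_setD aY bY aB bB.
- by have [->] := side_exit px aB bB ab.
- by rewrite e_sym in ab; have [->] := side_exit px bB aB ab.
Qed.

Lemma connD_side p x Y : e p x -> conn Y -> p \in Y -> conn (Y :\: side p x).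
Proof.
move=> px cY pY; set B := side p x.
apply: (@conn_retract Y _ (fun y => if y \in B then p else y)) => //.
- exact: subsetDl.
- by move=> y /setDP[_ /negPf->].
move=> a b aY bY ab.
case: ifPn => aB; case: ifPn => bB //.
- by have [_ ->] := side_exit px aB bB ab.
- by rewrite e_sym in ab; have [_ ->] := side_exit px bB aB ab.
- by apply: connect1; rewrite /induced /= ab ?in_setI ?in_setD aY bY aB bB.
Qed.

(** Any two neighbours of u are separated by u. *)
Lemma conn_two_nbrs u c c' Y : conn Y -> c \in Y -> c' \in Y ->
  e u c -> e u c' -> c != c' -> u \in Y.
Proof.
move=> cY cinY c'Y uc uc' ncc'.
have c'B : c' \notin side u c.
  apply/negP=> c'B; move: ncc'; rewrite e_sym in uc'.
  by have [->] := side_exit uc c'B (notin_side uc) uc'; rewrite eqxx.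
have [a [b [aB bB _ bY ab]]] := conn_crosses cY cinY c'Y (side_root u c) c'B.
by have [_ <-] := side_exit uc aB bB ab.
Qed.

(** Either x is a leaf of X, or x has a neighbour c in X other than p, and then
    [side x c] is strictly smaller than [side p x]. *)
Lemma leaf_in_side X p x : e p x -> conn X -> p \in X -> x \in X ->
  exists2 v, v \in side p x :&: X & exists q, [set w in X | e v w] = [set q].
Proof.
move=> px cX pX xX; move: {2}#|_|.+1 (ltnSn #|side p x :&: X|) => n.
elim: n p x px pX xX => // n IHn p x px pX xX; rewrite ltnS => len.
have [/existsP[c /and3P[cinX xc cp]]|] := boolP [exists c, [&& c \in X, e x c & c != p]].
  have cB : c \in side p x.
    apply: contraT => cB; have [_ ecp] := side_exit px (side_root p x) cB xc.
    by rewrite ecp eqxx in cp.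
  have sub : side x c \subset side p x.
    apply/subsetP=> z zC; apply: contraT => zB; move: (zC); rewrite inE => cz.
    have [a [b [aB bB /and3P[ab ax _]]]] := connect_crosses cz cB zB.
    by have [eax _] := side_exit px aB bB ab; rewrite eax !inE eqxx in ax.
  have [|v /setIP[vC vX] vl] := IHn x c xc xX cinX.
    apply: leq_trans len; apply: proper_card; apply/properP; split; first exact: setSI.
    exists x; first by rewrite in_setI side_root.
    by rewrite in_setI negb_and notin_side.
  by exists v => //; rewrite in_setI (subsetP sub).
rewrite negb_exists => /forallP noc.
exists x; first by rewrite in_setI side_root.
exists p; apply/setP=> w; rewrite !inE; apply/andP/eqP => [[wX xw]|->].
  by apply/eqP; have := noc w; rewrite wX xw /= negbK.
by rewrite e_sym.
Qed.

Lemma leaf_neq X r : conn X -> r \in X -> 1 < #|X| ->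
  exists2 v, v \in X :\ r & exists q, [set w in X | e v w] = [set q].
Proof.
move=> cX rX; rewrite (cardsD1 r) rX ltnS => /card_gt0P[y /setD1P[yr yX]].
have yB : y \notin [set r] by rewrite inE.
have [a [b [/set1P-> _ _ bX rb]]] := conn_crosses cX rX yX (set11 r) yB.
have [v /setIP[vB vX] vl] := leaf_in_side rb cX rX bX.
exists v => //; rewrite !inE vX andbT.
by apply: contraTneq vB => ->; apply: notin_side.
Qed.

(** * Generating polynomials of connected sets *)

Local Open Scope ring_scope.

(** The domain D makes deletion of vertices available: connected subsets of
    [D :\ p] containing a neighbour x of p are the subtrees of the branch at x
    away from p. *)
Definition subtree_poly D X : {poly rat} :=
  \sum_(Y : {set V} | [&& X \subset Y, Y \subset D & conn Y]) 'X^#|Y|.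

(** A connected set containing the edge px is the union of its part in
    [side p x], which avoids p, and of the rest, which avoids x; conversely any
    two such parts can be joined along px. *)
Lemma subtree_poly_factor D X p x : conn X -> X \subset D -> p \in X -> x \in D ->
    x \notin X -> e p x ->
  subtree_poly D (x |: X) = subtree_poly (D :\ x) X * subtree_poly (D :\ p) [set x].
Proof.
move=> cX XD pX xD xX px; set B := side p x.
rewrite /subtree_poly big_distrlr /= pair_big /=.
rewrite (reindex_onto (fun j : {set V} * {set V} => j.1 :|: j.2)
          (fun Y => (Y :\: B, Y :&: B))) /=; last by move=> Y _; rewrite setUC setID.
have XB y : y \in X -> y \notin B by move=> yX; apply: side_avoid px cX pX xX yX.
have disj Y Z : (Y :|: Z) :\: B = Y -> (Y :|: Z) :&: B = Z -> Y :&: Z = set0.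
  move=> eY eZ; apply/setP=> y; rewrite in_set0; apply/setIP=> -[].
  by rewrite -eY -eZ => /setDP[_ /negPf yB] /setIP[_]; rewrite yB.
apply: eq_big => [[Y Z]|[Y Z] /andP[_ /eqP[eY eZ]]] /=; last first.
  by rewrite -exprD cardsU (disj Y Z eY eZ) cards0 subn0.
apply/andP/andP => [[/and3P[xXYZ YZD cYZ] /eqP[eY eZ]]|].
  have [xYZ XYZ] : x \in Y :|: Z /\ X \subset Y :|: Z.
    by move: xXYZ; rewrite subUset sub1set => /andP.
  have pYZ := subsetP XYZ _ pX.
  split; apply/and3P; split.
  - apply/subsetP=> y yX; rewrite -eY; apply/setDP; split; last exact: XB.
    exact: (subsetP XYZ).
  - rewrite subsetD1 -{2}eY in_setD side_root andbT.
    by apply: subset_trans YZD; apply: subsetUl.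
  - by rewrite -eY; apply: connD_side.
  - by rewrite sub1set -eZ in_setI xYZ side_root.
  - rewrite subsetD1 -{2}eZ in_setI (negPf (notin_side px)) andbF andbT.
    by apply: subset_trans YZD; apply: subsetUr.
  - by rewrite -eZ; apply: connI_side.
(* Conversely, Y avoids the side of x and Z is contained in it, so both are
   recovered from their union. *)
case=> /and3P[XY]; rewrite subsetD1 => /andP[YD xY] cY /and3P[].
rewrite sub1set => xZ; rewrite subsetD1 => /andP[ZD pZ] cZ.
have pY := subsetP XY _ pX.
have YB y : y \in Y -> y \notin B by move=> yY; apply: side_avoid px cY pY xY yY.
have ZB y : y \in Z -> y \in B by move=> yZ; apply: side_trap px cZ xZ pZ yZ.
split.
  rewrite !subUset YD ZD sub1set inE xZ orbT (subset_trans XY (subsetUl _ _)) /=.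
  exact: connU cY cZ pY xZ px.
apply/eqP; congr (_, _); apply/setP=> y; rewrite ?(in_setD, in_setI) in_setU.
  case yY: (y \in Y); first by rewrite (YB y yY).
  by case yZ: (y \in Z); rewrite ?andbF // (ZB y yZ).
case yZ: (y \in Z); first by rewrite (ZB y yZ) orbT.
by case yY: (y \in Y) => //=; rewrite (negPf (YB y yY)).
Qed.

(** The summand 1 stands for the empty choice in the branch at x. *)
Lemma subtree_poly_split D X p x : conn X -> X \subset D -> p \in X -> x \in D ->
    x \notin X -> e p x ->
  subtree_poly D X = subtree_poly (D :\ x) X * (1 + subtree_poly (D :\ p) [set x]).
Proof.
move=> cX XD pX xD xX px.
rewrite mulrDr mulr1 -subtree_poly_factor // addrC.
rewrite {1}/subtree_poly (bigID [pred Y : {set V} | x \in Y]) /=.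
congr (_ + _); apply: eq_bigl => Y.
  by rewrite subUset sub1set; case: (x \in Y); rewrite /= ?andbT ?andbF.
by rewrite subsetD1; case: (x \in Y); rewrite /= ?andbT ?andbF.
Qed.

Definition nbrs u := [set w | e u w].

(** Once u is deleted, a connected set containing c meets no other neighbour
    of u. *)
Lemma subtree_poly_nbrs D C u c : C \subset nbrs u -> c \in nbrs u :\: C ->
  subtree_poly ((D :\: C) :\ u) [set c] = subtree_poly (D :\ u) [set c].
Proof.
move=> Cu /setDP[uc cC]; apply: eq_bigl => Y; rewrite !sub1set.
have [cY|//] := boolP (c \in Y); have [cnY|] := boolP (conn Y); last by rewrite !andbF.
rewrite !subsetD1 !andbT /= subsetD.
have [uY|uY] := boolP (u \in Y); rewrite ?andbF ?andbT //.
case: (Y \subset D) => //=; apply/pred0P=> c' /=; apply/andP=> -[c'Y c'C].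
have := subsetP Cu _ c'C; rewrite !inE in uc * => uc'.
apply/(negP uY)/(conn_two_nbrs cnY cY c'Y uc uc').
by apply: contraNneq cC => ->.
Qed.

(** A subtree containing u is obtained by choosing, for each remaining neighbour
    of u, nothing or a subtree of the branch at that neighbour.  The factors are
    split off one neighbour at a time. *)
Lemma subtree_poly_root D C u : u \in D -> nbrs u \subset D -> C \subset nbrs u ->
  subtree_poly (D :\: C) [set u] =
  'X * \prod_(c in nbrs u :\: C) (1 + subtree_poly (D :\ u) [set c]).
Proof.
move=> uD nD; move: {2}#|_| (erefl #|nbrs u :\: C|) => n.
elim: n C => [|n IHn] C.
  move/eqP; rewrite cards_eq0 => /eqP C0 Cu; rewrite C0 big_set0 mulr1.
  have uDC : u \in D :\: C.
    by rewrite inE uD andbT; apply/negP=> /(subsetP Cu); rewrite inE e_irr.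
  rewrite /subtree_poly (big_pred1 [set u]) ?cards1 // => Y.
  apply/and3P/eqP => [[]|->]; last by rewrite subxx sub1set conn1.
  rewrite sub1set => uY YDC cY; apply/eqP; rewrite eqEsubset sub1set uY andbT.
  apply/subsetP=> y yY; apply: contraT => yu.
  have [a [b [/set1P-> _ _ bY ub]]] := conn_crosses cY uY yY (set11 u) yu.
  have : b \in nbrs u :\: C by rewrite inE andbC inE ub; move/(subsetP YDC): bY => /setDP[].
  by rewrite C0 inE.
move=> sz Cu; have /card_gt0P[c cn] : (0 < #|nbrs u :\: C|)%N by rewrite sz.
have /setDP[uc cC] := cn.
have uC : u \notin C by apply/negP=> /(subsetP Cu); rewrite inE e_irr.
have euc : e u c by rewrite inE in uc.
rewrite (@subtree_poly_split _ _ u c) ?conn1 ?set11 //.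
- rewrite (@subtree_poly_nbrs D C u c) // setDDl setUC IHn.
  + rewrite -mulrA; congr (_ * _); rewrite [RHS](bigD1 c) //= mulrC; congr (_ * _).
    by apply: eq_bigl => y; rewrite !inE; case: (y \in C); case: (y == c); rewrite ?andbF ?andbT.
  + by apply/eqP; rewrite -eqSS -sz (cardsD1 c (_ :\: C)) cn setDDl setUC.
  + by rewrite subUset sub1set uc.
- by rewrite sub1set inE uC.
- by rewrite inE cC (subsetP nD).
- by rewrite inE eq_sym edge_neq.
Qed.

Lemma subtree_poly1 D X :
  (subtree_poly D X).[1] =
  #|[pred Y : {set V} | [&& X \subset Y, Y \subset D & conn Y]]|%:R.
Proof.
rewrite horner_sum (eq_bigr (fun=> 1)) ?sumr_const // => Y _.
by rewrite hornerXn expr1n.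
Qed.

Lemma subtree_poly_deriv1 D X :
  (subtree_poly D X)^`().[1] =
  \sum_(Y : {set V} | [&& X \subset Y, Y \subset D & conn Y]) #|Y|%:R.
Proof.
rewrite raddf_sum horner_sum; apply: eq_bigr => Y _ /=.
by rewrite derivXn hornerMn hornerXn expr1n.
Qed.

Lemma subtree_poly1_gt0 D X : conn X -> X \subset D -> 0 < (subtree_poly D X).[1].
Proof.
by move=> cX XD; rewrite subtree_poly1 ltr0n; apply/card_gt0P; exists X; rewrite inE subxx XD.
Qed.

Lemma mean_subtree_ge1 D x : x \in D -> 1 <= mean (subtree_poly D [set x]).
Proof.
move=> xD; rewrite /mean ler_pdivlMr ?subtree_poly1_gt0 ?conn1 ?sub1set // mul1r.
rewrite subtree_poly1 subtree_poly_deriv1 -sum1_card natr_sum.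
apply: ler_sum => Y /and3P[]; rewrite sub1set => xY _ _.
by rewrite ler1n; apply/card_gt0P; exists x.
Qed.

(** The growth of the mean when x is attached to a set containing p; see
    [mean_extend]. *)
Definition gain D p x : rat :=
  mean (subtree_poly (D :\ p) [set x]) / (1 + (subtree_poly (D :\ p) [set x]).[1]).

(** With a the polynomial of the connected sets containing X but not x, and n
    that of the branch at x, the two polynomials are [a * n] and [a * (1 + n)],
    so the difference of the means is [mean n - mean (1 + n)]. *)
Lemma mean_extend D X p x : conn X -> X \subset D -> p \in X -> x \in D ->
    x \notin X -> e p x ->
  mean (subtree_poly D (x |: X)) = mean (subtree_poly D X) + gain D p x.
Proof.
move=> cX XD pX xD xX px.
rewrite (subtree_poly_factor cX XD pX xD xX px) (subtree_poly_split cX XD pX xD xX px).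
have a0 : 0 < (subtree_poly (D :\ x) X).[1] by rewrite subtree_poly1_gt0 // subsetD1 XD.
have n0 : 0 < (subtree_poly (D :\ p) [set x]).[1].
  by rewrite subtree_poly1_gt0 ?conn1 // sub1set !inE eq_sym edge_neq.
rewrite !meanM ?gt_eqF ?mean_add1 // ?hornerD -?polyC1 ?hornerC ?addr_gt0 //.
by rewrite /gain; ring.
Qed.

(** Put g := [gain p u] and suppose that g_c := [gain u c] <= g for every
    neighbour c != p of u.  Let n_c be the number of subtrees that
    contain c but not u, and A the product of the [1 + n_c], which counts the
    subtrees that contain u but not p.  The product formula gives
      g (1 + A) = 1 + \sum g_c n_c <= 1 + g \sum n_c,
    while A >= 1 + \sum n_c + x y, where x <= y are n_c for two neighbours c.  Hence
    g (2 + x y) <= 1.  But g (1 + x) >= 1, because the mean order of the subtrees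
    in a branch is at least 1, and 1 + x < 2 + x y. *)
Lemma gain_branch D p u : u \in D -> nbrs u \subset D -> e p u ->
  (2 < #|nbrs u|)%N -> exists2 c, c \in nbrs u :\ p & gain D p u < gain D u c.
Proof.
move=> uD nD pu deg3.
have pnu : p \in nbrs u by rewrite inE e_sym.
set N := nbrs u :\ p.
have N2 : (1 < #|N|)%N by move: deg3; rewrite (cardsD1 p) pnu.
pose w c := subtree_poly (D :\ u) [set c]; pose n c := (w c).[1].
have cD c : c \in N -> c \in D :\ u.
  move=> /setD1P[_ cu]; rewrite inE (subsetP nD) // andbT inE.
  by apply: contraTneq cu => ->; rewrite inE e_irr.
have n0 c : c \in N -> 0 < n c.
  by move=> /cD cD'; rewrite /n subtree_poly1_gt0 ?conn1 // sub1set.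
have [/exists_inP //|] := boolP [exists c in N, gain D p u < gain D u c].
rewrite negb_exists_in => /forall_inP gle.
have {}gle c : c \in N -> gain D u c <= gain D p u by move=> /gle; rewrite -leNgt.
have g1 c : c \in N -> 1 <= gain D p u * (1 + n c).
  move=> cN; have n1 : 0 < 1 + n c by rewrite addr_gt0 ?n0.
  rewrite -ler_pdivrMr //; apply: le_trans (gle c cN).
  by rewrite /gain -/(w c) -/(n c) ler_wpM2r ?invr_ge0 ?(ltW n1) ?mean_subtree_ge1 ?cD.
have froot : subtree_poly (D :\ p) [set u] = 'X * \prod_(c in N) (1 + w c).
  by rewrite subtree_poly_root // sub1set.
have one c : (1 + w c).[1] = 1 + n c by rewrite hornerD -polyC1 hornerC.
have A1 : (subtree_poly (D :\ p) [set u]).[1] = \prod_(c in N) (1 + n c).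
  rewrite froot hornerM hornerX mul1r horner_prod.
  by apply: eq_bigr => c _; rewrite one.
have mu : mean (subtree_poly (D :\ p) [set u]) = 1 + \sum_(c in N) gain D u c * n c.
  rewrite froot meanM ?hornerX //; last first.
    rewrite horner_prod; apply/prodf_neq0 => c cN.
    by rewrite one gt_eqF // addr_gt0 ?n0.
  rewrite {1}/mean derivX -polyC1 hornerC hornerX divr1 polyC1 mean_prod; last first.
    by move=> c cN; rewrite one gt_eqF // addr_gt0 ?n0.
  congr (_ + _); apply: eq_bigr => c cN; rewrite mean_add1 ?n0 // /gain -/(w c) -/(n c).
  by field; rewrite gt_eqF // addr_gt0 ?n0.
have /card_gt1P[i [j [iN jN ij]]] := N2.
have prodge := @prod_add1_ge2 _ (fun c => c \in N) n i j.
have {prodge} := prodge (fun c cN => ltW (n0 c cN)) iN jN; rewrite eq_sym => /(_ ij).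
rewrite -A1; move: (n0 i iN) (n0 j jN) (g1 i iN) (g1 j jN).
have sle : \sum_(c in N) gain D u c * n c <= gain D p u * \sum_(c in N) n c.
  by rewrite mulr_sumr; apply: ler_sum => c cN; rewrite ler_wpM2r ?gle // ltW ?n0.
have A0 : 0 < (subtree_poly (D :\ p) [set u]).[1].
  by rewrite A1; apply: prodr_gt0 => c cN; rewrite addr_gt0 ?n0.
have geq : gain D p u * (1 + (subtree_poly (D :\ p) [set u]).[1]) =
           1 + \sum_(c in N) gain D u c * n c.
  by rewrite {1}/gain mu divfK // gt_eqF // addr_gt0.
move: A0 sle geq; set g := gain D p u; set a := _.[1]; set s := \sum_(c in N) n c.
set t := \sum_(c in N) _; move: (n i) (n j) => x y a0 sle geq x0 y0 gx gy age.
have g0 : 0 < g.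
  by rewrite -(pmulr_lgt0 _ (addr_gt0 ltr01 x0)); apply: lt_le_trans gx.
have gxy : g * (2 + x * y) <= 1.
  have : g * (1 + s + x * y) <= g * a by rewrite ler_wpM2l // ltW.
  by lra.
exfalso; have [xy|/ltW yx] := lerP x y.
  have : g * (1 + x) < g * (2 + x * y) by rewrite ltr_pM2l //; nra.
  by lra.
have : g * (1 + y) < g * (2 + x * y) by rewrite ltr_pM2l //; nra.
by lra.
Qed.

End Forest.

(** * Subtrees as connected vertex sets, and maximality *)

Section Tree.

Variables (V : finType) (T : graph V).
Hypothesis treeT : is_tree T.
Implicit Types (S H : graph V) (X Y : {set V}).

Let graphT : is_graph T. Proof. by case: treeT. Qed.

Lemma adj_sym G : symmetric (@adj V G).
Proof. by move=> x y; rewrite /adj /= setUC. Qed.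

Lemma adj_irr G : is_graph G -> irreflexive (@adj V G).
Proof.
move=> gG x; apply/negP=> /= xx.
by have /andP[_] := forall_inP gG _ xx; rewrite setUid cards1.
Qed.

Lemma adj_vertices G x y : is_graph G -> @adj V G x y -> (x \in vertices G) && (y \in vertices G).
Proof.
move=> gG xy; have /andP[/subsetP sub _] := forall_inP gG _ xy.
by rewrite !sub ?set21 ?set22.
Qed.

Let symT := adj_sym T.
Let irrT := adj_irr graphT.
Let acycT : forall c : seq V, uniq c -> cycle (adj T) c -> (size c <= 2)%N.
Proof. by case: treeT. Qed.

Lemma nbrs_vertices u : nbrs (adj T) u \subset vertices T.
Proof. by apply/subsetP => w; rewrite inE => /(adj_vertices graphT)/andP[]. Qed.

(** A subtree of T is an induced subgraph: an edge xy of T between two of its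
    vertices is the only edge that leaves [side x y], so a path of S from y to x
    must use it. *)
Lemma subtree_adj S x y : subtree T S ->
  adj S x y = [&& adj T x y, x \in vertices S & y \in vertices S].
Proof.
case/and4P=> gS /andP[_ eST] _ cS; apply/idP/and3P => [xy|[xy xS yS]].
  by have /andP[-> ->] := adj_vertices gS xy; split=> //; apply: (subsetP eST).
have cxy : connect (adj S) y x by exact: (forall_inP (forall_inP cS y yS) x xS).
have yB := side_root (adj T) x y.
have xB := notin_side irrT xy.
have [a [b [aB bB ab]]] := connect_crosses cxy yB xB.
have [<- <-] := side_exit irrT acycT xy aB bB (subsetP eST _ ab).
by rewrite adj_sym.
Qed.

Lemma subtree_conn S : subtree T S -> conn (adj T) (vertices S).
Proof.
move=> tS; have /and4P[_ _ _ /forall_inP cS] := tS.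
apply/connP => x y xS yS; apply: connect_sub (forall_inP (cS x xS) y yS) => a b ab.
by apply: connect1; rewrite /induced /= -subtree_adj.
Qed.

Lemma subtree_sub S : subtree T S -> vertices S \subset vertices T.
Proof. by case/and4P=> _ /andP[]. Qed.

Definition span X : graph V := (X, [set A in edges T | A \subset X]).

Lemma subtree_span X : X \subset vertices T -> X != set0 -> conn (adj T) X ->
  subtree T (span X).
Proof.
move=> XT X0 /connP cX; apply/and4P; split=> //.
- apply/forall_inP=> A; rewrite inE => /andP[AT ->] /=.
  by case/andP: (forall_inP graphT A AT).
- by rewrite /subgraph XT; apply/subsetP=> A; rewrite inE => /andP[].
- apply/forall_inP=> x xX; apply/forall_inP=> y yX.
  apply: connect_sub (cX x y xX yX) => a b /and3P[ab aX bX]; apply: connect1.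
  rewrite /adj /= inE; apply/andP; split=> //.
  by apply/subsetP=> z /set2P[]->.
Qed.

Lemma spanK S : subtree T S -> span (vertices S) = S.
Proof.
move=> tS; case/and4P: (tS) => gS /andP[_ eST] _ _.
rewrite /span [RHS]surjective_pairing; congr (_, _); apply/setP=> A; rewrite inE.
apply/andP/idP => [[AT AS]|AS]; last first.
  by split; [exact: (subsetP eST) | have /andP[] := forall_inP gS A AS].
have /andP[_ /cards2P[x [y [_ eA]]]] := forall_inP graphT A AT.
move: AS AT; rewrite eA subUset !sub1set => /andP[xS yS] xyT.
by have := subtree_adj x y tS; rewrite /adj /= /edges in xyT * => ->; rewrite xyT xS.
Qed.

Lemma sub_span X Y : X \subset Y -> subgraph (span X) (span Y).
Proof.
move=> XY; apply/andP; split=> //; apply/subsetP=> A; rewrite !inE => /andP[-> AX].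
exact: subset_trans AX XY.
Qed.

Lemma sum_subtrees (F : {set V} -> rat) S : subtree T S ->
  (\sum_(H : graph V | subtree T H && subgraph S H) F (vertices H) =
   \sum_(Y : {set V} | [&& vertices S \subset Y, Y \subset vertices T & conn (adj T) Y]) F Y)%R.
Proof.
move=> tS; rewrite (reindex_onto span (@vertices V)) /=; last first.
  by move=> H /andP[tH _]; apply: spanK.
apply: eq_bigl => Y; rewrite eqxx andbT; apply/andP/and3P => [[tY /andP[SY _]]|[SY YT cY]].
  by split=> //; [apply: (subtree_sub tY) | apply: (subtree_conn tY)].
split; last by rewrite -(spanK tS); apply: sub_span.
apply: subtree_span => //; apply: contraNneq (_ : vertices S != set0) => [Y0|].
  by rewrite -subset0 -Y0.
by case/and4P: tS.
Qed.

Lemma local_meanE S : subtree T S ->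
  local_mean T S = mean (subtree_poly (adj T) (vertices T) (vertices S)).
Proof.
move=> tS; rewrite /local_mean /mean subtree_poly1 subtree_poly_deriv1.
congr (_ / _)%R.
  by rewrite /sum_orders natr_sum (sum_subtrees (fun Y => #|Y|%:R)%R).
rewrite /num_subtrees -!sum1_card !natr_sum.
exact: (sum_subtrees (fun=> 1%R)).
Qed.

(** Both S and its competitor [(c |: vertices S) :\ u] arise from
    [c |: vertices S] by removing one vertex; the two gains are the corresponding
    losses of local mean. *)
Lemma k_maximal_gain k S p c u : k_maximal T k S ->
    p \in vertices S -> c \notin vertices S -> adj T p c -> 
    u \in vertices S -> 
    conn (adj T) ((c |: vertices S) :\ u) ->
  forall q, q \in c |: vertices S -> adj T q u ->
  (gain (adj T) (vertices T) p c <= gain (adj T) (vertices T) q u)%R.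
Proof.
set X := vertices S; case=> tS ordS maxS pX cX pc uX cU q qU qu.
have cT : c \in vertices T by case/andP: (adj_vertices graphT pc).
have XT : X \subset vertices T := subtree_sub tS.
have connX : conn (adj T) X := subtree_conn tS.
set X' := (c |: X) :\ u.
have X'T : X' \subset vertices T.
  by apply: subset_trans (subD1set _ _) _; rewrite subUset sub1set cT.
have cu : c != u by apply: contraNneq cX => ->.
have cX' : c \in X' by rewrite !inE cu eqxx.
have tX' : subtree T (span X').
  by apply: subtree_span => //; apply/set0Pn; exists c.
have oX' : gorder (span X') = k.
  have /eqP := cardsD1 u (c |: X).
  by rewrite in_setU uX orbT cardsU1 cX eqn_add2l -ordS /gorder => /eqP->.
have := maxS _ tX' oX'; rewrite !local_meanE //= -/X -/X'.
have := mean_extend symT irrT acycT connX XT pX cT cX pc.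
have uX' : u \notin X' by rewrite !inE eqxx.
have eX' : u |: X' = c |: X by rewrite setD1K // !inE uX orbT.
have qX' : q \in X'.
  by rewrite in_setD1 qU andbT; apply: contraTneq qu => ->; rewrite irrT.
have uT := subsetP XT u uX.
have := mean_extend symT irrT acycT cU X'T qX' uT uX' qu.
by rewrite eX' => -> ; lra.
Qed.

Lemma leaf_nbr S v : subtree T S -> leaf S v -> (1 < gorder S)%N ->
  exists2 q, q \in vertices S & adj T q v /\
    forall w, w \in vertices S -> adj T v w -> w = q.
Proof.
move=> tS /andP[vS]; case/orP=> [/cards1P[q eq]|/eqP->] // _.
have : q \in [set w | adj S v w] by rewrite eq set11.
rewrite inE subtree_adj // => /and3P[vq _ qS].
exists q => //; split; first by rewrite adj_sym.
move=> w wS vw; apply/set1P; rewrite -eq inE subtree_adj //; exact/and3P.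
Qed.

(** Exchange v for the neighbour c of u provided by [gain_branch]; c lies
    outside S because p is the only neighbour of u in S. *)
Lemma k_maximal_leaf_gain k S p u q v : k_maximal T k S ->
    u != v -> u \in vertices S -> v \in vertices S -> q \in vertices S ->
    adj T p u -> (forall w, w \in vertices S -> adj T u w -> w = p) ->
    adj T q v -> (forall w, w \in vertices S -> adj T v w -> w = q) ->
    2 < deg T u ->
  (gain (adj T) (vertices T) p u < gain (adj T) (vertices T) q v)%R.
Proof.
move=> maxS uv uS vS qS pu leafu qv leafv degu; have [tS _ _] := maxS.
have uT := subsetP (subtree_sub tS) u uS.
have [c /setD1P[cp uc] lt] := gain_branch symT irrT acycT uT (nbrs_vertices u) pu degu.
rewrite inE in uc; apply: lt_le_trans lt _.
have cS : c \notin vertices S by apply: contra cp => cS; apply/eqP/leafu.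
have cv : c != v by apply: contraNneq cS => ->.
have -> := k_maximal_gain maxS uS cS uc vS _ _ qv => //; last by rewrite inE qS orbT.
rewrite setDUl [_ :\ v](_ : _ = [set c]); last first.
  by apply/setP=> w; rewrite !inE; case: (w =P c) => [->|]; rewrite ?cv ?andbF.
apply: (conn_add symT _ _ uc); last by rewrite !inE uv.
by apply: (conn_remove_leaf symT (subtree_conn tS) qS _ leafv); apply: edge_neq qv.
Qed.

Lemma k_maximal_one_branching_leaf k S u v : k_maximal T k S ->
  leaf S u -> leaf S v -> 2 < deg T u -> 2 < deg T v -> u = v.
Proof.
move=> maxS lu lv du dv; have [tS _ _] := maxS; have [[uS _] [vS _]] := (andP lu, andP lv).
apply/eqP; apply: contraT => uv.
have k1 : 1 < gorder S by apply/card_gt1P; exists u, v.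
have [p pS [pu leafu]] := leaf_nbr tS lu k1.
have [q qS [qv leafv]] := leaf_nbr tS lv k1.
have := k_maximal_leaf_gain maxS uv uS vS qS pu leafu qv leafv du.
rewrite eq_sym in uv.
have := k_maximal_leaf_gain maxS uv vS uS pS qv leafv pu leafu dv.
by move/lt_trans=> h /h; rewrite ltxx.
Qed.

(** Move from v to the neighbour with the largest gain. *)
Lemma k_maximal_vertex k S v : k_maximal T k S -> vertices S = [set v] ->
  deg T v <= 2.
Proof.
move=> maxS eS; have [tS _ _] := maxS; rewrite leqNgt; apply/negP=> degv.
have vS : v \in vertices S by rewrite eS set11.
have vT := subsetP (subtree_sub tS) v vS.
have /card_gt0P[w0 w0n] : 0 < #|nbrs (adj T) v| by apply: leq_trans degv.
pose g w := gain (adj T) (vertices T) v w.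
case: (Order.TotalTheory.arg_maxP g w0n) => w wn wmax.
have vw : adj T v w by have : w \in nbrs (adj T) v := wn; rewrite inE.
have wv : adj T w v by rewrite adj_sym.
have [c /setD1P[_ cn] lt] := gain_branch symT irrT acycT vT (nbrs_vertices v) wv degv.
have wS : w \notin vertices S by rewrite eS inE eq_sym (edge_neq irrT vw).
have le : (g w <= gain (adj T) (vertices T) w v)%R.
  apply: (k_maximal_gain maxS vS wS vw vS _ _ wv); last by rewrite !inE eqxx.
  rewrite eS (_ : _ :\ v = [set w]) ?conn1 //.
  by apply/setP=> z; rewrite !inE; case: (z =P w) => [->|_]; rewrite ?andNb // andbT eq_sym (edge_neq irrT vw).
have := lt_le_trans lt (wmax c cn); rewrite ltNge.
by rewrite le.
Qed.

Lemma two_leaves S : subtree T S -> 1 < gorder S ->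
  exists u v, [/\ u != v, leaf S u & leaf S v].
Proof.
move=> tS k1.
have other r : r \in vertices S -> exists2 v, v != r & leaf S v.
  move=> rS; have [v /setD1P[vr vS] [q eq]] := leaf_neq symT irrT acycT (subtree_conn tS) rS k1.
  exists v => //; rewrite /leaf vS /deg (_ : [set w | _] = [set q]) ?cards1 //.
  by rewrite -eq; apply/setP=> w; rewrite !inE subtree_adj // vS andbC.
have /card_gt0P[r rS] : 0 < #|vertices S| by apply: leq_trans k1.
have [u _ lu] := other r rS; have /andP[uS _] := lu.
by have [v vu lv] := other u uS; exists v, u.
Qed.

End Tree.

Theorem mainTheorem1 (V : finType) (T : graph V) (k : nat) (S : graph V)
  (treeT : is_tree T) (k_gt0 : 0 < k) (k_le : k <= gorder T)
  (maxS : k_maximal T k S) :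
  #|[set v | leaf S v && (2 < deg T v)]| <= 1 /\
  exists v : V, leaf S v /\ deg T v <= 2.
Proof.
have one u v : leaf S u -> leaf S v -> 2 < deg T u -> 2 < deg T v -> u = v.
  exact: k_maximal_one_branching_leaf maxS.
split.
  by apply/card_le1P => u /[1!inE] /andP[lu du] v; rewrite !inE; apply/andP/eqP => [[lv dv]|->]; first exact: one.
have [tS ordS _] := maxS.
have [k1|] := ltnP 1 k.
  have [|u [v [uv lu lv]]] := two_leaves treeT tS; first by rewrite ordS.
  have [du|du] := leqP (deg T u) 2; first by exists u.
  exists v; split=> //; rewrite leqNgt; apply/negP=> dv.
  by rewrite (one u v) ?eqxx in uv.
rewrite leq_eqVlt ltnNge k_gt0 orbF => /eqP k1.
have /cards1P[v eS] : #|vertices S| == 1 by rewrite -k1 -ordS.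
exists v; split; last exact: k_maximal_vertex maxS eS.
by rewrite /leaf eS set11 ordS k1 eqxx orbT.
Qed.
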